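(* Let $G$ be a connected weighted graph of order $n\ge 3$, let $\mathcal P=\{V_1,\dots,V_m\}$ be a partition of $V(G)$ into $m$ nonempty parts, where $2\le m\le n-1$, and put $\tau=\tau(\mathcal P)$, $\rho=-\tau/(n-m)$ and $M=M_G$ (the normalized adjacency matrix of $G$). Then $$K(G)\ \ge\ \frac{(m-1)^2}{m-\tau}+\frac{(n-m)^2}{n-m+\tau},$$ with equality if and only if $$\operatorname{Spec}(M)=\Bigl\{1,\ \Bigl(\tfrac{\tau-1}{m-1}\Bigr)^{(m-1)},\ \rho^{(n-m)}\Bigr\}.$$
   Context: Graphs are finite, simple, connected, undirected and weighted: $G=(V,E,c)$ with symmetric weights $c(i,j)=c_{ij}=c_{ji}>0$ if $\{i,j\}\in E$ and $c_{ij}=0$ otherwise (no loops), $|V|=n$. The degree of vertex $i$ is $k_i=\sum_j c_{ij}$, $D=\operatorname{diag}(k_1,\dots,k_n)$, $A=(c_{ij})$ is the adjacency matrix, and $\operatorname{vol}(S)=\sum_{i\in S}k_i$ for $S\subseteq V$. The normalized adjacency matrix is $M_G=D^{-1/2}AD^{-1/2}$, with eigenvalues $1=\lambda_1>\lambda_2\ge\cdots\ge\lambda_n\ge-1$. Kemeny's constant is $K(G)=\sum_i\pi_i m_{ji}-1$ for the random walk with transition matrix $D^{-1}A$, where $\pi$ is the stationary distribution and $m_{ji}$ the mean first passage time from $j$ to $i$ (with $m_{jj}$ the mean first return time); this does not depend on $j$, and it is known that $K(G)=\sum_{j=2}^{n}\frac{1}{1-\lambda_j}$. For a partition $\mathcal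 P=\{V_1,\dots,V_m\}$ of $V(G)$ into nonempty parts, $\tau(\mathcal P)=\sum_{i=1}^m\frac{2e(V_i)}{\operatorname{vol}(V_i)}$, where $e(V_i)=\sum_{\{u,v\}\subseteq V_i}c_{uv}$ is the total edge weight inside $V_i$. $\operatorname{Spec}$ denotes the multiset of eigenvalues (with multiplicity), and $x^{(k)}$ means $x$ repeated $k$ times. *)

(* Defs.v *)
From mathcomp Require Import all_boot all_order all_algebra.
From mathcomp Require Import all_classical all_reals all_analysis.

Set Implicit Arguments.
Unset Strict Implicit.
Unset Printing Implicit Defensive.

Import Order.TTheory GRing.Theory Num.Theory.
Local Open Scope ring_scope.

Section WeightedGraph.
Variables (R : realType) (n : nat).
Implicit Types (c : 'M[R]_n) (S : {set 'I_n}) (P : {set {set 'I_n}}).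

(* A weighted graph on the vertex set 'I_n is given by its adjacency matrix;
   the edges are the pairs of positive weight. *)
Definition weighted_graph c :=
  [/\ forall i j, 0 <= c i j, forall i j, c i j = c j i & forall i, c i i = 0].

Definition edge c : rel 'I_n := fun i j => 0 < c i j.

Definition connected_graph c := forall i j, connect (edge c) i j.

Definition degree c (i : 'I_n) : R := \sum_j c i j.

Definition vol c S : R := \sum_(i in S) degree c i.

(* Each unordered pair of vertices is counted once, through u < v. *)
Definition inner_weight c S : R :=
  \sum_(u in S) \sum_(v in S | (u < v)%N) c u v.

Definition partition_tau c P : R :=
  \sum_(S in P) 2 * inner_weight c S / vol c S.

Definition normalized_adjacency c : 'M[R]_n :=
  let D' := diag_mx (\row_i (Num.sqrt (degree c i))^-1) in D' *m c *m D'.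

(* The multiset of eigenvalues of A, with algebraic multiplicities, is that of
   the entries of s. *)
Definition has_spectrum (A : 'M[R]_n) (s : seq R) :=
  char_poly A = \prod_(a <- s) ('X - a%:P).

Definition transition c : 'M[R]_n :=
  diag_mx (\row_i (degree c i)^-1) *m c.

End WeightedGraph.

Section MarkovChain.
Variables (R : realType) (n : nat) (P : 'M[R]_n).

Definition stationary (pi : 'rV[R]_n) :=
  [/\ forall i, 0 <= pi 0 i, \sum_i pi 0 i = 1 & pi *m P = pi].

(* A choice of stationary distribution; there is exactly one when P is the
   transition matrix of a connected graph. *)
Definition stationary_distribution : 'rV[R]_n :=
  xget 0 [set pi | stationary pi]%classic.

(* Probability that the chain started at j visits successively the states
   listed in s. *)
Fixpoint path_prob (j : 'I_n) (s : seq 'I_n) : R :=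
  if s is k :: s' then P j k * path_prob k s' else 1.

(* Probability that the chain started at j is at i at time t + 1 and at no
   time in 1, ..., t; time 0 is not constrained, so that j = i gives the first
   return. *)
Definition first_passage_prob (t : nat) (j i : 'I_n) : R :=
  \sum_(x : t.-tuple 'I_n | i \notin x) path_prob j (rcons x i).

(* The expectation of the first passage time, provided this time is almost
   surely finite, as is the case on a connected graph. *)
Definition mean_first_passage (j i : 'I_n) : \bar R :=
  (\sum_(0 <= t <oo) (t.+1%:R * first_passage_prob t j i)%:E)%E.

End MarkovChain.

(* Computed from the starting vertex j, on which it does not depend. *)
Definition kemeny (R : realType) (n : nat) (c : 'M[R]_n) (j : 'I_n) : \bar R :=
  let P := transition c in
  (\sum_(i < n) (stationary_distribution P 0%R i)%:E * mean_first_passage P j i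
    - 1)%E.

(* Main.v *)
(* Let v be the unit vector with entries sqrt (k_i / vol G), so that M v = v,
   and let N = 1 - M + v v^T, which is positive definite because G is connected.
   The mean first passage times solve a linear system whose solution is read
   off N^-1, whence K(G) = tr N^-1 - 1. Let Pi be the orthogonal projection on
   the span of the vectors D^(1/2) 1_{V_i}, which contains v. For a projection E
   of positive trace, Cauchy-Schwarz gives tr (E N^-1) >= (tr E)^2 / tr (E N),
   with equality only if N E is a multiple of E. The bound is the sum of the
   cases E = Pi - v v^T and E = 1 - Pi, since tr M = 0 and tr (Pi M) = tau.
   Equality forces N, hence M, to be a combination of v v^T, Pi - v v^T and
   1 - Pi, and its characteristic polynomial follows from Sylvester's
   determinant identity. Conversely the spectrum of M determines tr N^-1. *)
Require Import Defs.
From mathcomp Require Import all_boot all_order all_algebra.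
From mathcomp Require Import all_classical all_reals all_analysis.
From mathcomp Require Import ring lra.

Set Implicit Arguments.
Unset Strict Implicit.
Unset Printing Implicit Defensive.

Import Order.TTheory GRing.Theory Num.Theory.
Import numFieldNormedType.Exports.
Local Open Scope ring_scope.

(** * Characteristic polynomials *)

(** The block matrix with rows [y, A] and [B, 1] becomes upper triangular by a column operation and
    also by a row operation; comparing determinants avoids any division. *)
Lemma det_scalar_sub_mulC (R : comNzRingType) n m (A : 'M[R]_(n, m))
    (B : 'M[R]_(m, n)) (y : R) :
  y ^+ m * \det (y%:M - A *m B) = y ^+ n * \det (y%:M - B *m A).
Proof.
have e1 : block_mx y%:M A B 1%:M *m block_mx 1%:M 0 (- B) 1%:M
    = block_mx (y%:M - A *m B) A 0 1%:M.
  rewrite mulmx_block !mulmx1 !mulmx0 ?mul1mx !mulmxN ?add0r ?addr0.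
  by rewrite addrN.
have e2 : block_mx 1%:M 0 (- B) y%:M *m block_mx y%:M A B 1%:M
    = block_mx y%:M A 0 (y%:M - B *m A).
  rewrite mulmx_block !mul1mx !mul0mx !addr0 mulmx1 !mulNmx.
  by rewrite mul_scalar_mx mul_mx_scalar addNr addrC.
have := congr1 determinant e2; rewrite det_mulmx det_lblock det_ublock.
have := congr1 determinant e1; rewrite det_mulmx det_lblock det_ublock.
by rewrite !det1 !mulr1 !det_scalar !mul1r => ->.
Qed.

Lemma char_poly_mulC (R : comNzRingType) n m (A : 'M[R]_(n, m))
    (B : 'M[R]_(m, n)) :
  'X^m * char_poly (A *m B) = 'X^n * char_poly (B *m A).
Proof. by rewrite /char_poly /char_poly_mx !map_mxM det_scalar_sub_mulC. Qed.

Lemma horner_char_poly (R : comNzRingType) n (A : 'M[R]_n) x :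
  (char_poly A).[x] = \det (x%:M - A).
Proof.
rewrite -[LHS]/(horner_eval x _) -det_map_mx; congr (\det _).
apply/matrixP => i j; rewrite !mxE.
by rewrite rmorphB rmorphMn /= /horner_eval hornerX hornerC.
Qed.

Lemma char_poly_shift (R : comNzRingType) n (A : 'M[R]_n) b :
  char_poly (b%:M + A) = (char_poly A) \Po ('X - b%:P).
Proof.
rewrite -[RHS]/(comp_poly _ _) -det_map_mx; congr (\det _).
apply/matrixP => i j; rewrite !mxE.
rewrite rmorphB rmorphMn /= comp_polyX comp_polyC mulrnBl polyCD polyCMn.
by rewrite opprD addrA.
Qed.

(** Exchanging the two factors reduces the computation to the one by one matrix [a]. *)
Lemma char_poly_rank1 (R : idomainType) n (v : 'cV[R]_n.+1) a :
  v^T *m v = 1%:M ->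
  char_poly (a *: (v *m v^T)) = 'X^n * ('X - a%:P).
Proof.
move=> vv; have := char_poly_mulC (a *: v) v^T.
rewrite -scalemxAl -scalemxAr vv => e.
have X0 : 'X != 0 :> {poly R} by rewrite polyX_eq0.
apply: (mulfI X0); rewrite mulrA -exprS -['X * _]/('X^1 * _) e; congr (_ * _).
rewrite char_poly_trig ?scalemx1 ?scalar_mx_is_trig//.
by rewrite big_ord_recl big_ord0 mulr1 !mxE.
Qed.

(** Since [B C = 0], one has [(X - B)(X - C) = X (X - (B + C))]. *)
Lemma char_poly_orthoD (R : comNzRingType) n (B C : 'M[R]_n) :
  B *m C = 0 -> char_poly B * char_poly C = 'X^n * char_poly (B + C).
Proof.
move=> BC; rewrite /char_poly -det_mulmx -detZ; congr (\det _).
rewrite /char_poly_mx mulmxBl !mulmxBr -map_mxM/= BC map_mx0 subr0.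
rewrite !mul_scalar_mx mul_mx_scalar map_mxD -scalerBr -scalerBr.
by congr (_ *: _); rewrite opprD addrA addrAC.
Qed.

(** Puts 0 in place of the eigenvalue [a] carried by [v]: [M] is the sum of [M - a v v^T] and
    [a v v^T], whose product in this order vanishes. *)
Lemma char_poly_deflate (R : idomainType) n (M : 'M[R]_n) (v : 'cV[R]_n) a :
  v^T *m v = 1%:M -> M *m v = a *: v ->
  ('X - a%:P) * char_poly (M - a *: (v *m v^T)) = 'X * char_poly M.
Proof.
case: n M v => [|n] M v vv Mv.
  by have /eqP := congr1 (fun B : 'M[R]_1 => B 0 0) vv; rewrite !mxE big_ord0 eq_sym oner_eq0.
have X0 : 'X^n != 0 :> {poly R} by rewrite expf_neq0 ?polyX_eq0.
apply: (mulfI X0); rewrite mulrA -(char_poly_rank1 a vv) mulrA -exprSr mulrC.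
rewrite char_poly_orthoD ?subrK//.
rewrite mulmxBl -!(scalemxAl, scalemxAr) mulmxA Mv.
by rewrite mulmxA -[v *m v^T *m v]mulmxA vv mulmx1 -scalemxAl subrr.
Qed.

Lemma poly_eq_nonzero (R : numDomainType) (p q : {poly R}) :
  (forall x, x != 0 -> p.[x] = q.[x]) -> p = q.
Proof.
move=> pq; apply/eqP; rewrite -subr_eq0; apply/eqP.
(* The points 1, 2, ..., [size (p - q)] avoid 0 and are too many roots for the degree. *)
apply: (@roots_geq_poly_eq0 _ _ [seq i.+1%:R | i <- iota 0 (size (p - q))]).
- apply/allP => x /mapP[i _ ->].
  by rewrite rootE hornerD hornerN pq ?subrr// pnatr_eq0.
- rewrite map_inj_in_uniq ?iota_uniq// => i k _ _ /eqP.
  by rewrite eqr_nat eqSS => /eqP.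
- by rewrite size_map size_iota.
Qed.

(* With B the inverse, det (x - B) det (1 - A) = x ^ n det ((1 - 1/x) - A) for x
   nonzero, which gives the characteristic polynomial of B, hence its trace,
   without triangularizing A. *)
Lemma mxtrace_inv_one_sub (R : numFieldType) n (A : 'M[R]_n) (s : seq R) :
  char_poly A = \prod_(a <- s) ('X - a%:P) -> 1%:M - A \in unitmx ->
  \tr (invmx (1%:M - A)) = \sum_(a <- s) (1 - a)^-1.
Proof.
case: n A => [|n] A cpA uA.
  have := congr1 (size \o polyseq) cpA; rewrite /= size_char_poly size_prod_XsubC.
  by move=> [] /esym/size0nil ->; rewrite big_nil /mxtrace big_ord0.
have sz : size s = n.+1.
  by have := congr1 (size \o polyseq) cpA; rewrite /= size_char_poly size_prod_XsubC => -[].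
have detE x : \det (x%:M - A) = \prod_(a <- s) (x - a).
  rewrite -horner_char_poly cpA horner_prod.
  by apply: eq_bigr => a _; rewrite !hornerE.
have s1 a : a \in s -> 1 - a != 0.
  move=> sa; move: uA; rewrite unitmxE detE unitfE.
  by apply: contra => a1; rewrite prodf_seq_eq0; apply/hasP; exists a.
suff cpB : char_poly (invmx (1%:M - A)) = \prod_(b <- [seq (1 - a)^-1 | a <- s]) ('X - b%:P).
  have := char_poly_trace (invmx (1%:M - A)) (ltn0Sn n).
  have -> : n.+1.-1 = (size [seq (1 - a)^-1 | a <- s]).-1 by rewrite size_map sz.
  rewrite cpB coefPn_prod_XsubC ?size_map ?sz// => /oppr_inj <-.
  by rewrite big_map.
apply: poly_eq_nonzero => x x0.
have u0 : \det (1%:M - A) != 0 by rewrite -unitfE -unitmxE.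
apply: (mulIf u0); rewrite horner_char_poly -det_mulmx mulmxBl mulVmx// mul_scalar_mx.
have -> : x *: (1%:M - A) - 1%:M = x *: ((1 - x^-1)%:M - A).
  rewrite !scalerBr !scale_scalar_mx mulrBr mulr1 mulfV//.
  by rewrite [in RHS]raddfB/= addrAC.
rewrite detZ !detE horner_prod big_map -big_split/= -sz.
have -> : x ^+ size s = \prod_(a <- s) x by rewrite big_const_seq count_predT iter_mulr_1.
rewrite -big_split/=; apply: eq_big_seq => a sa; rewrite !hornerE.
by field; rewrite x0 s1.
Qed.

(** * Positive definite matrices and projections *)

Definition posdef (R : realFieldType) n (S : 'M[R]_n) :=
  S^T = S /\ forall x : 'cV[R]_n, x != 0 -> 0 < (x^T *m S *m x) 0 0.

Lemma posdef_unitmx (R : realFieldType) n (S : 'M[R]_n) :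
  posdef S -> S \in unitmx.
Proof.
move=> [_ S0]; rewrite -row_free_unit -kermx_eq0; apply/negPn/negP.
case/rowV0Pn=> u /sub_kermxP uS u0; have := S0 u^T.
by rewrite trmxK uS mul0mx mxE ltxx -(inj_eq trmx_inj) trmxK trmx0 u0 => /(_ isT).
Qed.

(** The form of [S^-1] at [x] is the form of [S] at [S^-1 x]. *)
Lemma posdef_invmx (R : realFieldType) n (S : 'M[R]_n) :
  posdef S -> posdef (invmx S).
Proof.
move=> pS; have uS := posdef_unitmx pS; have [St S0] := pS.
split=> [|x x0]; first by rewrite trmx_inv St.
have Sx0 : invmx S *m x != 0.
  by apply: contra_neq x0 => Sx; rewrite -(mulKVmx uS x) Sx mulmx0.
by have := S0 _ Sx0; rewrite trmx_mul trmx_inv St -!mulmxA mulKVmx.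
Qed.

Lemma mxtrace_congruence (R : realFieldType) n m (S : 'M[R]_n) (Y : 'M[R]_(n, m)) :
  \tr (Y^T *m S *m Y) = \sum_k ((col k Y)^T *m S *m col k Y) 0 0.
Proof.
apply: eq_bigr => k _; rewrite tr_col -!row_mul !mxE.
by apply: eq_bigr => i _; rewrite !mxE.
Qed.

Lemma posdef_mxtrace_ge0 (R : realFieldType) n m (S : 'M[R]_n) (Y : 'M[R]_(n, m)) :
  posdef S -> 0 <= \tr (Y^T *m S *m Y).
Proof.
move=> [_ S0]; rewrite mxtrace_congruence sumr_ge0// => k _.
have [->|/S0/ltW//] := eqVneq (col k Y) 0.
by rewrite mulmx0 mxE.
Qed.

Lemma posdef_mxtrace_eq0 (R : realFieldType) n m (S : 'M[R]_n) (Y : 'M[R]_(n, m)) :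
  posdef S -> \tr (Y^T *m S *m Y) = 0 -> Y = 0.
Proof.
move=> [_ S0]; rewrite mxtrace_congruence => /eqP.
rewrite psumr_eq0 => [/allP Y0|k _]; last first.
  have [->|/S0/ltW//] := eqVneq (col k Y) 0.
  by rewrite mulmx0 mxE.
apply/matrixP => i k; rewrite mxE.
have /= := Y0 k (mem_index_enum k).
have [Yk0 _|/S0] := eqVneq (col k Y) 0; last by case: ltrgt0P.
by have := congr1 (fun B : 'cV[R]_n => B i 0) Yk0; rewrite !mxE.
Qed.

Section Projection.
Variables (R : realFieldType) (n : nat) (S E : 'M[R]_n).
Hypotheses (S_pos : posdef S) (E_sym : E^T = E) (E_idem : E *m E = E).
Hypothesis trE : 0 < \tr E.

(** This trace is that of [E^T S E], which vanishes only for [E = 0]. *)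
Lemma proj_mxtrace_gt0 : 0 < \tr (E *m S).
Proof.
have -> : \tr (E *m S) = \tr (E^T *m S *m E).
  by rewrite E_sym [RHS]mxtrace_mulC mulmxA E_idem.
rewrite lt_neqAle posdef_mxtrace_ge0// andbT eq_sym.
by apply: contraTneq trE => /(posdef_mxtrace_eq0 S_pos) ->; rewrite mxtrace0 ltxx.
Qed.

(** Squared length of [E - t S E] for the inner product given by [S^-1], expanded in [t]; its
    nonnegativity at the best [t] is the Cauchy-Schwarz inequality. *)
Lemma proj_mxtrace_defect (t : R) (Y := E - t *: (S *m E)) :
  \tr (Y^T *m invmx S *m Y) =
  \tr (E *m invmx S) - 2 * t * \tr E + t ^+ 2 * \tr (E *m S).
Proof.
have uS := posdef_unitmx S_pos; have [S_sym _] := S_pos.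
have trB (A B : 'M[R]_n) : \tr (A - B) = \tr A - \tr B by rewrite linearB.
have -> : Y^T = E - t *: (E *m S).
  by rewrite /Y linearB/= linearZ/= trmx_mul S_sym E_sym.
rewrite /Y !mulmxBl !mulmxBr -!(scalemxAl, scalemxAr).
rewrite !(mulmxA _ S E) !mulmxKV// !mulmxK// E_idem !(trB, mxtraceZ).
rewrite [\tr (E *m invmx S *m E)]mxtrace_mulC mulmxA E_idem.
rewrite [\tr (E *m S *m E)]mxtrace_mulC mulmxA E_idem.
by ring.
Qed.

(* Where the quadratic polynomial of proj_mxtrace_defect is minimal. *)
Let t := \tr E / \tr (E *m S).

Let defectE :
  \tr (E *m invmx S) - (\tr E) ^+ 2 / \tr (E *m S) =
  \tr ((E - t *: (S *m E))^T *m invmx S *m (E - t *: (S *m E))).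
Proof.
rewrite proj_mxtrace_defect /t; field.
by rewrite gt_eqF// proj_mxtrace_gt0.
Qed.

Lemma proj_mxtrace_inv_ge :
  (\tr E) ^+ 2 / \tr (E *m S) <= \tr (E *m invmx S).
Proof.
by rewrite -subr_ge0 defectE posdef_mxtrace_ge0//; apply: posdef_invmx.
Qed.

(** A zero defect forces [E = t S E] by definiteness, and [t] is nonzero. *)
Lemma proj_mxtrace_inv_eq :
  \tr (E *m invmx S) = (\tr E) ^+ 2 / \tr (E *m S) ->
  S *m E = (\tr (E *m S) / \tr E) *: E.
Proof.
move/eqP; rewrite -subr_eq0 defectE => /eqP /(posdef_mxtrace_eq0 (posdef_invmx S_pos)).
move/subr0_eq => EtSE; have trES := proj_mxtrace_gt0.
have -> : \tr (E *m S) / \tr E = t^-1 by rewrite invf_div.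
by rewrite [in RHS]EtSE scalerK// mulf_neq0 ?invr_eq0 ?gt_eqF.
Qed.

End Projection.

(** The matrix is [b + W B W^T], where [B] is a scalar plus a rank one matrix of size [m.+1]; since
    [W^T W = 1], exchanging factors leaves the characteristic polynomial of [B] times a power of
    [X]. *)
Lemma char_poly_two_level (R : idomainType) n m (W : 'M[R]_(n, m.+1))
    (w : 'cV[R]_m.+1) a b :
  (m < n)%N -> W^T *m W = 1%:M -> w^T *m w = 1%:M ->
  let v := W *m w in
  char_poly (v *m v^T + a *: (W *m W^T - v *m v^T) + b *: (1%:M - W *m W^T)) =
  \prod_(x <- 1 :: nseq m a ++ nseq (n - m.+1) b) ('X - x%:P).
Proof.
move=> mn WW ww v.
pose B : 'M[R]_m.+1 := (a - b)%:M + (1 - a) *: (w *m w^T).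
have -> : v *m v^T + a *: (W *m W^T - v *m v^T) + b *: (1%:M - W *m W^T) =
    b%:M + W *m B *m W^T.
  rewrite mulmxDr mulmxDl mul_mx_scalar -!(scalemxAl, scalemxAr) /v trmx_mul !mulmxA.
  by apply/matrixP => i k; rewrite !mxE; ring.
have cpB : char_poly B = ('X - (a - b)%:P) ^+ m * ('X - (1 - b)%:P).
  rewrite char_poly_shift char_poly_rank1// comp_polyM comp_polyB comp_polyX comp_polyC.
  by rewrite rmorphXn/= comp_polyX; congr (_ * _); rewrite !polyCB; ring.
have cpW : char_poly (W *m B *m W^T) = 'X^(n - m.+1) * char_poly B.
  have Xm0 : 'X^(m.+1) != 0 :> {poly R} by rewrite expf_neq0 ?polyX_eq0.
  apply: (mulfI Xm0); rewrite mulrA -exprD subnKC// -mulmxA char_poly_mulC.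
  by rewrite -mulmxA WW mulmx1.
rewrite char_poly_shift cpW cpB !comp_polyM !rmorphXn/= !comp_polyB !comp_polyX !comp_polyC.
rewrite big_cons big_cat !big_nseq/= !iter_mulr_1 !polyCB.
rewrite mulrA mulrC; congr (_ * _); first by ring.
rewrite mulrC; congr (_ ^+ _ * _); by ring.
Qed.

(** * Trace of an inverse split along three orthogonal projections *)

Section TwoLevelBound.
Variables (R : realFieldType) (n m : nat) (M : 'M[R]_n).
Variables (W : 'M[R]_(n, m.+1)) (w : 'cV[R]_m.+1).
Hypotheses (m_gt0 : (0 < m)%N) (m_ltn : (m.+1 < n)%N).
Hypotheses (WW : W^T *m W = 1%:M) (ww : w^T *m w = 1%:M).
Let v := W *m w.
Let N := 1%:M - M + v *m v^T.
Hypotheses (Mv : M *m v = v) (trM : \tr M = 0).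
Hypothesis N_pos : posdef N.
Let tau := \tr (W *m W^T *m M).

(** Orthogonal projections adding up to the identity, of traces 1, [m] and [n - m.+1]. In this
    section [m] is one less than the number of parts. *)
Let E0 := v *m v^T.
Let E1 := W *m W^T - E0.
Let E2 := 1%:M - W *m W^T.

Let vv : v^T *m v = 1%:M.
Proof. by rewrite trmx_mul mulmxA -(mulmxA w^T) WW mulmx1. Qed.

Let Wv : W *m W^T *m v = v.
Proof. by rewrite -mulmxA (mulmxA W^T) WW mul1mx. Qed.

Let E0_sym : E0^T = E0. Proof. by rewrite trmx_mul trmxK. Qed.

Let WW_sym : (W *m W^T)^T = W *m W^T. Proof. by rewrite trmx_mul trmxK. Qed.

Let WE0 : W *m W^T *m E0 = E0. Proof. by rewrite mulmxA Wv. Qed.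

Let E0W : E0 *m (W *m W^T) = E0.
Proof. by rewrite -[LHS]trmxK trmx_mul E0_sym WW_sym WE0. Qed.

Let E00 : E0 *m E0 = E0.
Proof. by rewrite mulmxA -(mulmxA v) vv mulmx1. Qed.

Let WWW : W *m W^T *m (W *m W^T) = W *m W^T.
Proof. by rewrite mulmxA -(mulmxA W) WW mulmx1. Qed.

Let E1_sym : E1^T = E1. Proof. by rewrite linearB/= WW_sym E0_sym. Qed.

Let E2_sym : E2^T = E2. Proof. by rewrite linearB/= trmx1 WW_sym. Qed.

Let E11 : E1 *m E1 = E1.
Proof. by rewrite mulmxBl !mulmxBr WWW WE0 E0W E00 subrr subr0. Qed.

Let E22 : E2 *m E2 = E2.
Proof. by rewrite mulmxBl !mulmxBr WWW !mul1mx mulmx1 subrr subr0. Qed.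

Let trE0 : \tr E0 = 1. Proof. by rewrite mxtrace_mulC vv mxtrace_scalar. Qed.

Let trWW : \tr (W *m W^T) = m.+1%:R.
Proof. by rewrite mxtrace_mulC WW mxtrace_scalar. Qed.

Let trE1 : \tr E1 = m%:R.
Proof. by rewrite linearB/= trWW trE0 -natr1 addrK. Qed.

Let trE2 : \tr E2 = n%:R - m.+1%:R.
Proof. by rewrite linearB/= trWW mxtrace_scalar. Qed.

Let ME0 : M *m E0 = E0. Proof. by rewrite mulmxA Mv. Qed.

Let NE0 : N *m E0 = E0.
Proof. by rewrite mulmxDl mulmxBl mul1mx ME0 subrr add0r E00. Qed.

Let trE0N : \tr (E0 *m N) = 1. Proof. by rewrite mxtrace_mulC NE0. Qed.

Let trWN : \tr (W *m W^T *m N) = m.+1%:R - tau + 1.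
Proof. by rewrite mulmxDr mulmxBr mulmx1 WE0 linearD linearB/= trWW trE0. Qed.

Let trE1N : \tr (E1 *m N) = m.+1%:R - tau.
Proof. by rewrite mulmxBl linearB/= trWN trE0N addrK. Qed.

Let trE2N : \tr (E2 *m N) = n%:R - m.+1%:R + tau.
Proof.
rewrite mulmxBl mul1mx linearB/= trWN /N linearD linearB/= trM mxtrace_scalar trE0.
by rewrite subr0; ring.
Qed.

Let trE1_gt0 : 0 < \tr E1. Proof. by rewrite trE1 ltr0n. Qed.

Let trE2_gt0 : 0 < \tr E2. Proof. by rewrite trE2 subr_gt0 ltr_nat. Qed.

(** The inverse of [N] fixes [E0], whose trace 1 is the amount subtracted. *)
Let tr_invmx :
  \tr (invmx N) - 1 = \tr (E1 *m invmx N) + \tr (E2 *m invmx N).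
Proof.
have E0N : invmx N *m E0 = E0 by rewrite -{1}NE0 mulKmx// posdef_unitmx.
rewrite !mulmxBl mul1mx !linearB/= [\tr (E0 *m _)]mxtrace_mulC E0N trE0; ring.
Qed.

Let bound := m%:R ^+ 2 / (m.+1%:R - tau)
  + (n%:R - m.+1%:R) ^+ 2 / (n%:R - m.+1%:R + tau).

Lemma two_level_bound : bound <= \tr (invmx N) - 1.
Proof.
rewrite tr_invmx lerD// -?trE1N -?trE2N -?trE1 -?trE2.
  exact: proj_mxtrace_inv_ge.
exact: proj_mxtrace_inv_ge.
Qed.

Lemma two_level_bound_eqP :
  \tr (invmx N) - 1 = bound <->
  char_poly M = \prod_(x <- 1 :: nseq m ((tau - 1) / m%:R)
      ++ nseq (n - m.+1) (- tau / (n%:R - m.+1%:R))) ('X - x%:P).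
Proof.
have m0 : m%:R != 0 :> R by rewrite pnatr_eq0 -lt0n.
have nm0 : n%:R - m.+1%:R != 0 :> R by rewrite gt_eqF// -trE2.
have N10 : m.+1%:R - tau != 0 by rewrite gt_eqF// -trE1N proj_mxtrace_gt0.
have N20 : n%:R - m.+1%:R + tau != 0 by rewrite gt_eqF// -trE2N proj_mxtrace_gt0.
split=> [tight|cpM].
  have ge1 := proj_mxtrace_inv_ge N_pos E1_sym E11 trE1_gt0.
  have ge2 := proj_mxtrace_inv_ge N_pos E2_sym E22 trE2_gt0.
  have {}tight : \tr (E1 *m invmx N) + \tr (E2 *m invmx N) =
    \tr E1 ^+ 2 / \tr (E1 *m N) + \tr E2 ^+ 2 / \tr (E2 *m N).
    by rewrite -tr_invmx tight trE1 trE2 trE1N trE2N.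
  (* Two lower bounds whose sum is attained are attained separately. *)
  have [eq1 eq2] : \tr (E1 *m invmx N) = \tr E1 ^+ 2 / \tr (E1 *m N) /\
      \tr (E2 *m invmx N) = \tr E2 ^+ 2 / \tr (E2 *m N).
    move: ge1 ge2 tight; move: (\tr (E1 *m invmx N)) (\tr (E2 *m invmx N)).
    by move: (_ / _) (_ / _) => a b x y ax bY xy; split; lra.
  have := proj_mxtrace_inv_eq N_pos E2_sym E22 trE2_gt0 eq2.
  have := proj_mxtrace_inv_eq N_pos E1_sym E11 trE1_gt0 eq1.
  rewrite trE1 trE2 trE1N trE2N => NE1 NE2.
  rewrite -(char_poly_two_level _ _ (ltnW m_ltn) WW ww); congr char_poly.
  rewrite -/v -/E0 -/E1 -/E2.
  (* Obtained by multiplying [M = 1 - N + E0] by the three projections, which add up to 1, and using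
     [N E0 = E0]. *)
  have -> : M = E0 + (E1 - N *m E1) + (E2 - N *m E2).
    have -> : E0 + (E1 - N *m E1) + (E2 - N *m E2)
        = (E0 + E1 + E2) - N *m (E0 + E1 + E2) + N *m E0.
      by rewrite !mulmxDr; apply/matrixP => i k; rewrite !mxE; ring.
    rewrite NE0 /E1 /E2.
    have -> : E0 + (W *m W^T - E0) + (1%:M - W *m W^T) = 1%:M.
      by apply/matrixP => i k; rewrite !mxE; ring.
    by rewrite mulmx1 /N -/E0; apply/matrixP => i k; rewrite !mxE; ring.
  (* On [E1] and [E2] the matrix [M] acts as one minus the scalar by which [N] acts. *)
  rewrite NE1 NE2 -{1}(scale1r E1) -{1}(scale1r E2) -!scalerBl.
  congr (_ + _ *: _ + _ *: _); rewrite -?natr1; field.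
    by rewrite m0.
  by rewrite natr1.
have uN := posdef_unitmx N_pos.
have NE : N = 1%:M - (M - E0) by rewrite opprB addrA addrAC.
(* [N] is 1 minus the deflated matrix [M - E0], so the spectrum of the latter gives the trace of the
   inverse; its eigenvalue 0 contributes the 1 to be subtracted. *)
have cpD : char_poly (M - E0) = \prod_(x <- 0 :: nseq m ((tau - 1) / m%:R)
      ++ nseq (n - m.+1) (- tau / (n%:R - m.+1%:R))) ('X - x%:P).
  have X1 : 'X - 1%:P != 0 :> {poly R} by rewrite polyXsubC_eq0.
  have := char_poly_deflate vv (etrans Mv (esym (scale1r v))).
  rewrite scale1r cpM !big_cons mulrCA => /(mulfI X1) ->.
  by rewrite subr0.
rewrite NE (mxtrace_inv_one_sub cpD) -?NE// big_cons big_cat/= !big_nseq.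
rewrite !iter_addr_0 subr0 invr1 -[_ *+ m]mulr_natl -[_ *+ (n - _)]mulr_natl.
rewrite natrB ?(ltnW m_ltn)// /bound.
rewrite -natr1 in N10 N20 nm0 *.
by field; rewrite N10 N20 nm0 m0.
Qed.

End TwoLevelBound.

(** * Mean first passage times *)

Lemma first_passage_prob0 (R : realType) n (P : 'M[R]_n) j i :
  first_passage_prob P 0 j i = P j i.
Proof.
rewrite /first_passage_prob (bigD1 [tuple])//= mulr1 big1 ?addr0// => x.
by rewrite [x]tuple0 => /andP[_ /eqP].
Qed.

(** Conditioning on the first step: a tuple of [t.+1] states is a head and a tail. *)
Lemma first_passage_probS (R : realType) n (P : 'M[R]_n) t j i :
  first_passage_prob P t.+1 j i =
  \sum_(k | k != i) P j k * first_passage_prob P t k i.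
Proof.
rewrite /first_passage_prob; under [RHS]eq_bigr do rewrite big_distrr/=.
rewrite pair_big_dep/=.
rewrite (reindex (fun p : 'I_n * t.-tuple 'I_n => [tuple of p.1 :: p.2]))/=.
  by apply: eq_bigl => -[k x]/=; rewrite inE negb_or eq_sym.
exists (fun x => (thead x, [tuple of behead x])) => [[k x] _|x _]/=.
  by congr (_, _); apply: val_inj.
by rewrite [in RHS](tuple_eta x).
Qed.

(** With [q] the square root of [r], each of the [N.+1] terms of a geometric sum bounded by
    [1 / (1 - q)] is at least [q ^ N]; the second factor [q ^ N] tends to 0. *)
Lemma cvg_mul_expr (R : realType) (r : R) : 0 <= r < 1 ->
  ((fun N => N.+1%:R * r ^+ N) @ \oo --> (0 : R))%classic.
Proof.
move=> /andP[r0 r1]; set q := Num.sqrt r.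
have q0 : 0 <= q by rewrite sqrtr_ge0.
have q1 : q < 1 by rewrite -sqrtr1 ltr_sqrt.
have qr : q ^+ 2 = r by rewrite sqr_sqrtr.
have bnd N : N.+1%:R * q ^+ N <= (1 - q)^-1.
  rewrite -[leRHS]div1r ler_pdivlMr ?subr_gt0//.
  have : 1 - q ^+ N.+1 <= 1 by rewrite gerBl exprn_ge0.
  apply: le_trans; rewrite -[leRHS]opprB subrX1 -mulNr opprB mulrC ler_pM2l ?subr_gt0//.
  rewrite mulr_natl -[X in _ *+ X](card_ord N.+1) -sumr_const ler_sum// => k _.
  by rewrite ler_wiXn2l// ?ltW// -ltnS ltn_ord.
apply: (@squeeze_cvgr _ _ _ _ (fun=> 0) (fun N => (1 - q)^-1 * q ^+ N)).
- near=> N; rewrite mulr_ge0 ?exprn_ge0//= -qr exprAC expr2 mulrA.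
  by rewrite ler_wpM2r ?exprn_ge0.
- exact: cvg_cst.
- by apply: cvg_geometric; rewrite ger0_norm.
Unshelve. all: by end_near. Qed.

Section FirstPassage.
Variables (R : realType) (n : nat) (P : 'M[R]_n) (i : 'I_n) (g : 'I_n -> R).
Hypotheses (P_ge0 : forall j k, 0 <= P j k) (P_sum1 : forall j, \sum_k P j k = 1).

(** Transition operator of the walk killed on entering [i]. *)
Let Q (f : 'I_n -> R) j := \sum_(k | k != i) P j k * f k.

Let Q_le f h : (forall j, f j <= h j) -> forall j, Q f j <= Q h j.
Proof. by move=> fh j; apply: ler_sum => k _; rewrite ler_wpM2l. Qed.

Let QZ a f j : Q (fun k => a * f k) j = a * Q f j.
Proof. by rewrite /Q big_distrr/=; apply: eq_bigr => k _; rewrite mulrCA. Qed.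

Let QD f h j : Q (fun k => f k + h k) j = Q f j + Q h j.
Proof. by rewrite /Q -big_split/=; apply: eq_bigr => k _; rewrite mulrDr. Qed.

(* s t j is the probability, starting at j, of not visiting i at times 1 to t. *)
Let s t := iter t Q (fun=> 1).
Let a t := iter t Q g.

Let s_ge0 t j : 0 <= s t j.
Proof.
elim: t j => [|t IH] j //=; apply: sumr_ge0 => k _.
by rewrite mulr_ge0//; exact: IH.
Qed.

(** The first passage takes place at time [t.+1] when [i] is avoided up to [t] but not up to
    [t.+1]. *)
Let fppE t j : first_passage_prob P t j i = s t j - s t.+1 j.
Proof.
elim: t j => [|t IH] j.
  rewrite first_passage_prob0 /= /Q; under eq_bigr do rewrite mulr1.
  by rewrite -(P_sum1 j) (bigD1 i)//= addrK.
rewrite first_passage_probS /= /Q -sumrB; apply: eq_bigr => k _.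
by rewrite IH mulrBr.
Qed.

Hypothesis gE : forall j, g j = 1 + \sum_(k | k != i) P j k * g k.

(** Minimum principle: at a negative minimum, the equation and the total mass at most 1 of the
    killed walk would give [g l < g l]. So [g] is nonnegative, and the equation gives the 1. *)
Let g_ge1 j : 1 <= g j.
Proof.
suff g0 k : 0 <= g k by rewrite gE lerDl sumr_ge0// => k _; rewrite mulr_ge0.
have [l _ lmin] := @Order.TotalTheory.arg_minP _ _ _ j xpredT g isT.
apply: le_trans (lmin k isT); rewrite leNgt; apply/negP => gl0.
suff : g l < g l by rewrite ltxx.
rewrite [ltRHS]gE.
have : \sum_(k | k != i) P l k * g l <= \sum_(k | k != i) P l k * g k.
  by apply: ler_sum => k' _; rewrite ler_wpM2l// lmin.
rewrite -(lerD2l 1); apply: lt_le_trans; rewrite -big_distrl/=.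
have : \sum_(k | k != i) P l k <= 1.
  by rewrite -(P_sum1 l) [leRHS](bigD1 i)//= lerDr.
by nra.
Qed.

Let C := \sum_j g j.

Let g_leC j : g j <= C.
Proof.
by rewrite /C (bigD1 j)//= lerDl sumr_ge0// => k _; apply: le_trans (g_ge1 k).
Qed.

Let C_ge1 : 1 <= C. Proof. exact: le_trans (g_ge1 i) (g_leC i). Qed.

Let r := 1 - C^-1.

Let r01 : 0 <= r < 1.
Proof.
have C0 : 0 < C := lt_le_trans ltr01 C_ge1.
by rewrite /r subr_ge0 gtrBl invr_gt0 C0 invf_le1 ?C_ge1.
Qed.

Let aE t j : a t j = s t j + a t.+1 j.
Proof.
elim: t j => [|t IH] j; first exact: gE.
rewrite [RHS]/= -QD; congr (Q _ j); apply/funext => k; exact: IH.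
Qed.

Let s_le_a t j : s t j <= a t j.
Proof. by elim: t j => [|t IH] j; [exact: g_ge1|exact: Q_le]. Qed.

Let a_le t j : a t j <= r ^+ t * g j.
Proof.
elim: t j => [|t IH] j; first by rewrite mul1r.
rewrite [leLHS]/= (le_trans (Q_le IH j))// QZ exprSr -mulrA ler_wpM2l ?exprn_ge0//.
  by case/andP: r01.
have := gE j; rewrite -/(Q g j) /r mulrBl mul1r => {1}->.
have C0 : 0 < C := lt_le_trans ltr01 C_ge1.
have : C^-1 * g j <= 1 by rewrite mulrC ler_pdivrMr// mul1r g_leC.
by have := gE j; rewrite -/(Q g j); lra.
Qed.

(** Summation by parts leaves the sum of the [s t j] for [t < N], minus [N] times [s N j]; the sum
    of tails telescopes to [g j - a N j]. *)
Let partial_sum N j :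
  \sum_(0 <= t < N) (t.+1%:R * first_passage_prob P t j i) =
  g j - (a N j + N%:R * s N j).
Proof.
elim: N => [|N IH]; first by rewrite big_nil mul0r addr0 subrr.
rewrite big_nat_recr// [LHS]/= IH fppE aE -[N.+1%:R]natr1.

ring.
Qed.

(* Since g <= C, one has Q g = g - 1 <= r g: the iterates of g, and with them the
   tails s, decay geometrically. *)
Lemma mean_first_passageE j : mean_first_passage P j i = (g j)%:E.
Proof.
apply/cvg_lim => //.
under eq_fun do rewrite sumEFin partial_sum.
apply: cvg_EFin; first exact: nearW.
rewrite -[X in (_ --> X)%classic]subr0; apply: cvgB; first exact: cvg_cst.
(* As [s N j <= a N j], the remainder is at most [N.+1] times [a N j]. *)
apply: (@squeeze_cvgr _ _ _ _ (fun=> 0) (fun N => g j * (N.+1%:R * r ^+ N))).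
- near=> N.
  have aN0 : 0 <= a N j by apply: le_trans (s_ge0 N j) (s_le_a N j).
  rewrite addr_ge0 ?mulr_ge0//= mulrCA [g j * _]mulrC -natr1 mulrDl mul1r addrC.
  by rewrite lerD// ler_wpM2l// (le_trans (s_le_a N j)).
- exact: cvg_cst.
- by rewrite -[X in (_ --> X)%classic](mulr0 (g j)); apply: cvgMr; exact: cvg_mul_expr.
Unshelve. all: by end_near. Qed.

End FirstPassage.

(** * Random walk on a weighted graph *)

Section RandomWalk.
Variables (R : realType) (n : nat) (c : 'M[R]_n).
Hypotheses (c_graph : weighted_graph c) (c_conn : connected_graph c).
Hypothesis n_gt1 : (1 < n)%N.

Let c_ge0 i k : 0 <= c i k. Proof. by case: c_graph. Qed.

Let c_sym i k : c i k = c k i. Proof. by case: c_graph. Qed.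

Let deg := degree c.

(** A path to some other vertex must leave [i] along an edge. *)
Lemma degree_gt0 i : 0 < degree c i.
Proof.
rewrite lt_neqAle sumr_ge0 ?andbT => [|k _]; last exact: c_ge0.
apply/negP => /eqP/esym/eqP; rewrite psumr_eq0 => [/allP d0|k _]; last exact: c_ge0.
have [k ki] : exists k, k != i.
  have /card_gt0P[k] : (0 < #|[set~ i]|)%N by rewrite cardsC1 card_ord -subn1 subn_gt0.
  by rewrite !inE; exists k.
have /connectP[[|l p]/=] := c_conn i k; first by move=> _ ki'; rewrite ki' eqxx in ki.
by rewrite /edge; have /= /eqP -> := d0 l (mem_index_enum l); rewrite ltxx.
Qed.

Let deg_gt0 i : 0 < deg i := degree_gt0 i.

(** The energy is twice the quadratic form of the Laplacian [D - A], by symmetry of [c]. *)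
Lemma dirichlet_energyE (f : 'I_n -> R) :
  \sum_i \sum_k c i k * (f i - f k) ^+ 2 =
  2 * (\sum_i degree c i * f i ^+ 2 - \sum_i \sum_k c i k * f i * f k).
Proof.
have e1 : \sum_i \sum_k c i k * f i ^+ 2 = \sum_i degree c i * f i ^+ 2.
  by apply: eq_bigr => i _; rewrite -mulr_suml.
have e2 : \sum_i \sum_k c i k * f k ^+ 2 = \sum_i degree c i * f i ^+ 2.
  rewrite -e1 exchange_big; apply: eq_bigr => i _.
  by apply: eq_bigr => k _; rewrite c_sym.
rewrite mulrBr mulr_natl mulr2n -{1}e1 -e2 -!big_split/= mulr_sumr -sumrB.
apply: eq_bigr => i _; rewrite mulr_sumr -big_split -sumrB/=.
by apply: eq_bigr => k _; ring.
Qed.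

Lemma dirichlet_energy_ge0 (f : 'I_n -> R) :
  0 <= \sum_i \sum_k c i k * (f i - f k) ^+ 2.
Proof. by do 2![apply: sumr_ge0 => ? _]; rewrite mulr_ge0 ?sqr_ge0. Qed.

(** Zero energy makes [f] constant along edges, hence along paths. *)
Lemma dirichlet_energy_eq0 (f : 'I_n -> R) :
  \sum_i \sum_k c i k * (f i - f k) ^+ 2 = 0 -> forall i k, f i = f k.
Proof.
move/eqP; rewrite psumr_eq0 => [/allP f0|i _]; last first.
  by apply: sumr_ge0 => k _; rewrite mulr_ge0 ?sqr_ge0.
have fe i k : edge c i k -> f i = f k.
  rewrite /edge => cik; have /= := f0 i (mem_index_enum i).
  rewrite psumr_eq0 => [/allP/(_ k (mem_index_enum k))/=|l _]; last first.
    by rewrite mulr_ge0 ?sqr_ge0.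
  by rewrite mulf_eq0 gt_eqF//= sqrf_eq0 subr_eq0 => /eqP.
move=> i k; have /connectP[p] := c_conn i k.
by elim: p i => [|l p IH] i /= => [_ ->//|/andP[/fe -> /IH]]; apply.
Qed.

Let transE k l : transition c k l = (deg k)^-1 * c k l.
Proof. by rewrite /transition mul_diag_mx !mxE. Qed.

Let V := \sum_i deg i.

Let V_gt0 : 0 < V.
Proof.
rewrite /V (bigD1 (Ordinal (ltnW n_gt1)))//= ltr_pwDl// sumr_ge0// => i _.
exact: ltW.
Qed.

Lemma stationary_distributionE i :
  stationary_distribution (transition c) 0 i = degree c i / V.
Proof.
suff -> : stationary_distribution (transition c) = \row_k (deg k / V) by rewrite mxE.
apply: xget_unique => [|pi [pi0 pi1 piP]].
  split=> [k||]; first by rewrite mxE divr_ge0// ltW.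
    under eq_bigr do rewrite mxE.
    by rewrite -mulr_suml divff// gt_eqF.
  apply/rowP => k; rewrite !mxE -[deg k]/(\sum_l c k l) mulr_suml.
  apply: eq_bigr => l _; rewrite mxE transE c_sym; field.
  by rewrite !gt_eqF.
(* For uniqueness, the density of [pi] with respect to the degrees is harmonic, so its energy is
   zero and it is constant; the total mass fixes the constant. *)
pose f k := pi 0 k / deg k.
have fE k : pi 0 k = deg k * f k by rewrite mulrC divfK// gt_eqF.
have harm k : \sum_l c k l * f l = deg k * f k.
  rewrite -fE -[in RHS]piP mxE; apply: eq_bigr => l _.
  by rewrite transE c_sym fE /f; field; rewrite gt_eqF.
have fconst : forall k l, f k = f l.
  apply: dirichlet_energy_eq0; rewrite dirichlet_energyE.
  apply/eqP; rewrite mulf_eq0 pnatr_eq0/= subr_eq0; apply/eqP.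
  apply: eq_bigr => k _; rewrite expr2 mulrA -harm mulr_suml.
  by apply: eq_bigr => l _; rewrite mulrAC.
apply/rowP => k; rewrite mxE fE; congr (_ * _).
apply: (mulfI (lt0r_neq0 V_gt0)); rewrite divff ?gt_eqF// -pi1 mulr_suml.
by apply: eq_bigr => l _; rewrite fE (fconst k l).
Qed.

(** * Normalized adjacency matrix and fundamental matrix *)

Let s i := Num.sqrt (deg i).
Let s_gt0 i : 0 < s i. Proof. by rewrite sqrtr_gt0. Qed.

Let s0 i : s i != 0. Proof. by rewrite gt_eqF. Qed.

Let s2 i : s i ^+ 2 = deg i. Proof. by rewrite sqr_sqrtr// ltW. Qed.

Let V0 : Num.sqrt V != 0. Proof. by rewrite gt_eqF// sqrtr_gt0. Qed.

Let V2 : Num.sqrt V ^+ 2 = V. Proof. by rewrite sqr_sqrtr// ltW. Qed.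

Let M := normalized_adjacency c.

Lemma normalized_adjacencyE i k :
  normalized_adjacency c i k =
  c i k / (Num.sqrt (degree c i) * Num.sqrt (degree c k)).
Proof.
rewrite /normalized_adjacency mul_mx_diag mul_diag_mx !mxE invfM.
by rewrite mulrAC mulrC.
Qed.

Let ME i k : M i k = c i k / (s i * s k). Proof. exact: normalized_adjacencyE. Qed.

Definition perron_vector : 'cV[R]_n :=
  \col_i (Num.sqrt (degree c i) / Num.sqrt (\sum_k degree c k)).

Let v := perron_vector.
Let vE i : v i 0 = s i / Num.sqrt V. Proof. by rewrite mxE. Qed.

Lemma perron_vector_unit : perron_vector^T *m perron_vector = 1%:M.
Proof.
apply/matrixP => i k; rewrite !ord1 !mxE/=.
under eq_bigr => l _ do rewrite mxE vE -expr2 expr_div_n s2 V2.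
by rewrite -mulr_suml divff// gt_eqF.
Qed.

Lemma normalized_adjacency_perron :
  normalized_adjacency c *m perron_vector = perron_vector.
Proof.
apply/colP => i; rewrite vE mxE.
transitivity (\sum_k c i k * ((s i)^-1 / Num.sqrt V)).
  by apply: eq_bigr => k _; rewrite ME vE; field; rewrite !s0 V0.
by rewrite -mulr_suml -[\sum_k _]/(deg i) -s2; field; rewrite s0 V0.
Qed.

Lemma normalized_adjacency_sym : (normalized_adjacency c)^T = normalized_adjacency c.
Proof. by apply/matrixP => i k; rewrite mxE !ME c_sym mulrC [s i * _]mulrC mulrC. Qed.

Lemma mxtrace_normalized_adjacency : \tr (normalized_adjacency c) = 0.
Proof. by rewrite /mxtrace big1// => i _; rewrite ME; case: c_graph => _ _ ->; rewrite mul0r. Qed.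

(* D^(-1/2) fundamental_mx^-1 D^(1/2) is the Kemeny-Snell fundamental matrix
   (1 - P + 1 pi)^-1 of the walk; the symmetric form is used instead. *)
Definition fundamental_mx : 'M[R]_n :=
  1%:M - normalized_adjacency c + perron_vector *m perron_vector^T.

Let N := fundamental_mx.

(** With [x = D^(1/2) f], the form is half the energy of [f] plus the square of [v^T x]. If both
    vanish, [f] is constant and [v^T x] is a nonzero multiple of that constant. *)
Lemma fundamental_mx_posdef : posdef fundamental_mx.
Proof.
split.
  by rewrite linearD linearB/= trmx1 normalized_adjacency_sym trmx_mul trmxK.
move=> x x0; pose f i := x i 0 / s i.
have xE i : x i 0 = s i * f i by rewrite mulrC divfK.
have quadE : (x^T *m N *m x) 0 0 =
    2^-1 * (\sum_i \sum_k c i k * (f i - f k) ^+ 2) + ((v^T *m x) 0 0) ^+ 2.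
  rewrite dirichlet_energyE mulKf ?pnatr_eq0//.
  have D1 (A B : 'M[R]_1) : (A + B) 0 0 = A 0 0 + B 0 0 by rewrite mxE.
  have B1 (A B : 'M[R]_1) : (A - B) 0 0 = A 0 0 - B 0 0 by rewrite !mxE.
  rewrite mulmxDr mulmxBr mulmx1 mulmxDl mulmxBl D1 B1; congr (_ - _ + _).
  - by rewrite !mxE; apply: eq_bigr => i _; rewrite mxE xE -[degree c i]s2; ring.
  - rewrite -mulmxA mxE; apply: eq_bigr => i _; rewrite !mxE mulr_sumr.
    by apply: eq_bigr => k _; rewrite ME !xE; field; rewrite !s0.
  - rewrite mulmxA -mulmxA mxE big_ord1 expr2; congr (_ * _).
    by rewrite !mxE; apply: eq_bigr => i _; rewrite [x^T _ _]mxE [v^T _ _]mxE mulrC.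
rewrite quadE lt_neqAle addr_ge0 ?andbT ?sqr_ge0 ?mulr_ge0 ?dirichlet_energy_ge0 ?invr_ge0//.
apply: contra x0 => /eqP/esym/eqP.
rewrite paddr_eq0 ?sqr_ge0 ?mulr_ge0 ?dirichlet_energy_ge0 ?invr_ge0//.
rewrite mulf_eq0 invr_eq0 pnatr_eq0/= sqrf_eq0 => /andP[/eqP/dirichlet_energy_eq0 fc].
move=> vx; apply/eqP/colP => i; rewrite xE mxE.
suff -> : f i = 0 by rewrite mulr0.
move: vx; have -> : (v^T *m x) 0 0 = Num.sqrt V * f i.
  rewrite mxE; transitivity (\sum_k deg k * (f i / Num.sqrt V)).
    by apply: eq_bigr => k _; rewrite mxE vE xE -s2 (fc k i); ring.
  by rewrite -mulr_suml -[X in X * _]V2; field.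
by rewrite mulf_eq0 (negPf V0) => /eqP.
Qed.

Let uN : N \in unitmx := posdef_unitmx fundamental_mx_posdef.
Let Z := invmx N.

Let Nv : N *m v = v.
Proof.
rewrite mulmxDl mulmxBl mul1mx normalized_adjacency_perron subrr add0r.
by rewrite -mulmxA perron_vector_unit mulmx1.
Qed.

Let Zv : Z *m v = v. Proof. by rewrite -{1}Nv mulKmx. Qed.

Let vZ : v^T *m Z = v^T.
Proof.
have [Zs _] := posdef_invmx fundamental_mx_posdef.
by rewrite -[Z]Zs -trmx_mul Zv.
Qed.

(** Comes from [N Z = 1]; entry by entry it becomes the first step equation for the passage
    times. *)
Let MZ : M *m Z = Z - 1%:M + v *m v^T.
Proof.
have -> : M = 1%:M - N + v *m v^T.
  by apply/matrixP => i k; rewrite !mxE; ring.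
by rewrite mulmxDl mulmxBl mul1mx mulmxV// -mulmxA vZ.
Qed.

(* The classical formula m_ji = (delta_ij - z_ji + z_ii) / pi_i, where z is the
   Kemeny-Snell fundamental matrix. *)
Lemma transition_mean_first_passage i j :
  mean_first_passage (transition c) j i =
  ((((i == j)%:R - (s j)^-1 * Z j i * s i + Z i i) / (deg i / V))%:E)%E.
Proof.
have trans1 k : \sum_l transition c k l = 1.
  under eq_bigr do rewrite transE.
  by rewrite -mulr_sumr mulVf// gt_eqF.
apply: (@mean_first_passageE _ _ _ _ (fun k =>
   ((i == k)%:R - (s k)^-1 * Z k i * s i + Z i i) / (deg i / V))) => [k l|//|].
  by rewrite transE mulr_ge0// invr_ge0 ltW.
move=> {}j.
(* Entry [(j, i)] of [MZ], conjugated by [D^(1/2)] to turn [M] into the transition matrix. *)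
have ZE : \sum_k transition c j k * ((s k)^-1 * Z k i * s i) =
    (s j)^-1 * Z j i * s i - (i == j)%:R + deg i / V.
  have := congr1 (fun B : 'M[R]_n => (s j)^-1 * B j i * s i) MZ.
  rewrite !mxE big_ord1 [v^T _ _]mxE !vE => MZji.
  transitivity ((s j)^-1 * (\sum_k M j k * Z k i) * s i).
    rewrite mulr_sumr mulr_suml; apply: eq_bigr => k _.
    by rewrite transE ME -s2; field; rewrite !s0.
  have -> : deg i / V = (s i / Num.sqrt V) ^+ 2 by rewrite expr_div_n s2 V2.
  rewrite MZji; have [->|_] := eqVneq i j.
    by rewrite /=; field; rewrite s0 V0.
  by rewrite /=; field; rewrite s0 V0.
have dV : deg i / V != 0 by rewrite mulf_neq0 ?invr_eq0 ?gt_eqF.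
(* The excluded index [k = i] may be restored, as its term [Z i i - Z i i] is zero. *)
have -> : \sum_(k | k != i) transition c j k *
    (((i == k)%:R - (s k)^-1 * Z k i * s i + Z i i) / (deg i / V)) =
    (\sum_k transition c j k * (Z i i - (s k)^-1 * Z k i * s i)) / (deg i / V).
  rewrite [in RHS](bigD1 i)//= [(s i)^-1 * _]mulrC mulfVK// subrr mulr0 add0r.
  rewrite [RHS]mulr_suml; apply: eq_bigr => k ki.
  by rewrite eq_sym (negPf ki) sub0r mulrA [- _ + _]addrC.
under [in RHS]eq_bigr do rewrite mulrBr.
rewrite sumrB -mulr_suml trans1 mul1r ZE; move: (deg i / V) dV => z z0.
by field; rewrite z0 s0.
Qed.

(** The factors [pi_i] cancel, and [Z v = v] gives the conjugated matrix row sums 1, which cancel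
    the Kronecker delta; only the trace remains, whatever [j] is. *)
Lemma kemenyE j : kemeny c j = (\tr (invmx fundamental_mx) - 1)%:E.
Proof.
rewrite /kemeny.
under eq_bigr => i _ do rewrite stationary_distributionE transition_mean_first_passage -EFinM.
rewrite sumEFin -EFinB; congr (_ - 1)%:E.
transitivity (\sum_i ((i == j)%:R - (s j)^-1 * Num.sqrt V * (Z j i * v i 0) + Z i i)).
  apply: eq_bigr => i _.
  have dV : deg i / V != 0 by rewrite mulf_neq0 ?invr_eq0 ?gt_eqF.
  rewrite mulrC divfK// vE.
  by congr (_ - _ + _); field; rewrite s0 V0.
rewrite big_split sumrB/= -mulr_sumr.
have -> : \sum_i Z j i * v i 0 = v j 0 by rewrite -[in RHS]Zv mxE.
rewrite (bigD1 j)//= eqxx big1 => [|i /negPf->//].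
have -> : (s j)^-1 * Num.sqrt V * v j 0 = 1 by rewrite vE; field; rewrite s0 V0.
by rewrite addr0 subrr add0r.
Qed.

End RandomWalk.

(** * The partition *)

Section PartitionMatrix.
Variables (R : realType) (n : nat) (c : 'M[R]_n).
Hypotheses (c_graph : weighted_graph c) (c_conn : connected_graph c).
Hypothesis n_gt1 : (1 < n)%N.
Variables (P : {set {set 'I_n}}) (m : nat).
Hypotheses (P_part : finset.partition P [set: 'I_n]%SET) (P_card : #|P| = m).

Let deg_gt0 i : 0 < degree c i := degree_gt0 c_graph c_conn n_gt1 i.
Let s i := Num.sqrt (degree c i).
Let s2 i : s i ^+ 2 = degree c i. Proof. by rewrite sqr_sqrtr// ltW. Qed.

Let vol_gt0 S : S \in P -> 0 < vol c S.
Proof.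
move=> SP; have /set0Pn[i iS] : S != finset.set0.
  by apply: contraTneq SP => ->; case/and3P: P_part.
by rewrite /vol (bigD1 i)//= ltr_pwDl// sumr_ge0// => k _; exact: ltW.
Qed.

(** Numbering the parts lets them index the columns of a matrix. *)
Definition part (k : 'I_m) : {set 'I_n} := enum_val (cast_ord (esym P_card) k).

Let part_in k : part k \in P. Proof. exact: enum_valP. Qed.

Let sum_part (F : {set 'I_n} -> R) : \sum_k F (part k) = \sum_(S in P) F S.
Proof.
rewrite [RHS]big_enum_val [RHS](reindex (cast_ord (esym P_card)))//=.
by exists (cast_ord P_card) => k _; rewrite ?cast_ordK ?cast_ordKV.
Qed.

Let part_disjoint k l i : i \in part k -> i \in part l -> k = l.
Proof.
have /and3P[_ tP _] := P_part => ik il.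
apply/(@cast_ord_inj _ _ (esym P_card))/enum_val_inj.
by rewrite -[LHS](def_pblock tP (part_in k) ik) (def_pblock tP (part_in l) il).
Qed.

(** The columns are the vectors [D^(1/2) 1_{V_k}] scaled to unit length, so [W W^T] is the
    projection on their span. *)
Definition partition_mx : 'M[R]_(n, m) :=
  \matrix_(i, k) if i \in part k then s i / Num.sqrt (vol c (part k)) else 0.

(** Coordinates of the Perron vector in the basis formed by these columns. *)
Definition partition_weight : 'cV[R]_m :=
  \col_k (Num.sqrt (vol c (part k)) / Num.sqrt (\sum_i degree c i)).

Let sv0 k : Num.sqrt (vol c (part k)) != 0.
Proof. by rewrite gt_eqF// sqrtr_gt0 vol_gt0. Qed.

Lemma partition_mx_orthonormal : partition_mx^T *m partition_mx = 1%:M.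
Proof.
apply/matrixP => k l; rewrite !mxE.
have [<-{l}|kl] := eqVneq k l; last first.
  apply: big1 => i _; rewrite !mxE; case: ifP => [ik|]; last by rewrite mul0r.
  case: ifP => [il|]; last by rewrite mulr0.
  by rewrite (part_disjoint ik il) eqxx in kl.
transitivity (\sum_(i in part k) degree c i / vol c (part k)).
  rewrite [RHS]big_mkcond; apply: eq_bigr => i _; rewrite !mxE.
  case: ifP => _; last by rewrite mulr0.
  by rewrite -expr2 expr_div_n s2 sqr_sqrtr// ltW// vol_gt0.
by rewrite -mulr_suml divff// gt_eqF// vol_gt0.
Qed.

Lemma partition_mx_weight : partition_mx *m partition_weight = perron_vector c.
Proof.
apply/colP => i; rewrite !mxE.
have /and3P[_ tP _] := P_part.
have iP : i \in finset.cover P by rewrite (finset.cover_partition P_part) inE.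
rewrite -/(s i); set z := s i / _.
transitivity (\sum_k (if i \in part k then z else 0)).
  apply: eq_bigr => k _; rewrite !mxE; case: ifP => _; last by rewrite mul0r.
  by rewrite mulrA mulfVK.
rewrite (sum_part (fun S => if i \in S then z else 0)).
rewrite (bigD1 (finset.pblock P i)) ?finset.pblock_mem//= mem_pblock iP big1 ?addr0// => S.
case/andP=> SP; case: ifP => // iS.
by rewrite (finset.def_pblock tP SP iS) eqxx.
Qed.

Lemma partition_weight_unit : partition_weight^T *m partition_weight = 1%:M.
Proof.
rewrite -(perron_vector_unit c_graph c_conn n_gt1) -partition_mx_weight.
by rewrite trmx_mul mulmxA -(mulmxA _ partition_mx^T) partition_mx_orthonormal mulmx1.
Qed.

(** Every unordered pair is met in both orders, and the diagonal of [c] is zero. *)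
Lemma double_inner_weight (S : {set 'I_n}) :
  2 * inner_weight c S = \sum_(i in S) \sum_(k in S) c i k.
Proof.
have [_ c_sym c0] := c_graph.
have split i k : c i k = (if (i < k)%N then c i k else 0)
    + (if (k < i)%N then c k i else 0).
  case: ltngtP => [||ik]; rewrite ?addr0 ?add0r//.
  by rewrite (val_inj ik) c0.
under eq_bigr => i _ do under eq_bigr => k _ do rewrite split.
under eq_bigr => i _ do rewrite big_split.
rewrite big_split/= [X in _ + X]exchange_big/= mulr_natl mulr2n.
by congr (_ + _); apply: eq_bigr => i _; apply: big_mkcondr.
Qed.

(** After a cyclic shift, the diagonal entry of [W^T M W] at [k] is the term of the part [V_k]: the
    square roots of the degrees cancel. *)
Lemma mxtrace_partition_mx :
  \tr (partition_mx *m partition_mx^T *m normalized_adjacency c) =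
  partition_tau c P.
Proof.
rewrite -mulmxA mxtrace_mulC /partition_tau -sum_part; apply: eq_bigr => k _.
rewrite double_inner_weight -mulmxA mxE mulr_suml [RHS]big_mkcond.
apply: eq_bigr => i _; rewrite !mxE; case: ifP => ik; last by rewrite mul0r.
rewrite mulr_sumr mulr_suml [RHS]big_mkcond; apply: eq_bigr => l _.
rewrite [partition_mx _ _]mxE; case: ifP => lk; last by rewrite !mulr0.
rewrite normalized_adjacencyE -[in RHS](@sqr_sqrtr _ (vol c (part k))); last first.
  by rewrite ltW// vol_gt0.
rewrite -/(s i) -/(s l).
by field; rewrite sv0 !gt_eqF ?sqrtr_gt0.
Qed.

End PartitionMatrix.

Theorem theorem3p4 (R : realType) (n : nat) (c : 'M[R]_n) (j : 'I_n)
    (m : nat) (P : {set {set 'I_n}}) :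
  (3 <= n)%N ->
  weighted_graph c ->
  connected_graph c ->
  finset.partition P [set: 'I_n]%SET ->
  #|P| = m ->
  (2 <= m)%N -> (m <= n.-1)%N ->
  let tau := partition_tau c P in
  let rho := - tau / (n%:R - m%:R) in
  let M := normalized_adjacency c in
  let bound := (m%:R - 1) ^+ 2 / (m%:R - tau)
               + (n%:R - m%:R) ^+ 2 / (n%:R - m%:R + tau) in
  (bound%:E <= kemeny c j)%E /\
  (kemeny c j = bound%:E <->
   has_spectrum M
     (1 :: nseq m.-1 ((tau - 1) / (m%:R - 1)) ++ nseq (n - m) rho)).
Proof.
move=> n_ge3 c_graph c_conn P_part P_card m_ge2 m_le tau rho M bound.
have n_gt1 : (1 < n)%N by apply: ltn_trans n_ge3.
have m_ltn : (m < n)%N by rewrite -(prednK (ltnW n_gt1)) ltnS.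
(* Writing the number of parts as [m.+1] turns the bound [2 <= m] into [0 < m], as the two-level
   bound requires. *)
case: m P_card m_ge2 m_le m_ltn @rho @bound => // m P_card m_gt0 _ m_ltn rho bound.
have WW := partition_mx_orthonormal c_graph c_conn n_gt1 P_part P_card.
have ww := partition_weight_unit c_graph c_conn n_gt1 P_part P_card.
have Ww := partition_mx_weight c_graph c_conn n_gt1 P_part P_card.
have trW := mxtrace_partition_mx c_graph c_conn n_gt1 P_part P_card.
have N_pos := fundamental_mx_posdef c_graph c_conn n_gt1.
have Mv := normalized_adjacency_perron c_graph c_conn n_gt1.
rewrite kemenyE// lee_fin /fundamental_mx -Ww in N_pos Mv *.
have trM := mxtrace_normalized_adjacency c_graph.
have := two_level_bound m_gt0 m_ltn WW ww Mv trM N_pos.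
have := two_level_bound_eqP m_gt0 m_ltn WW ww Mv trM N_pos.
rewrite trW -/tau => eqP le.
have m1 : m.+1%:R - 1 = m%:R :> R by rewrite -natr1 addrK.
rewrite /bound /rho m1; split=> //.
by rewrite /has_spectrum -eqP; split=> [[]|->].
Qed.
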